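(* Let $(\eta(t))_{t\in\mathbb{Z}_+}$ be the nonlinear process and assume $\mathbb{E}(\eta(0))=r\in[0,1)$ and $\mathbb{E}(e^{\lambda\eta(0)})<+\infty$ for some $\lambda>0$. Then $\eta(t)$ converges in distribution to $\pi_{\rho_r}$ as $t\to+\infty$, where $\rho_r:=1+r-\sqrt{1+r^2}$.
   Context: The nonlinear process $(\eta(t))_{t\in\mathbb{Z}_+}$ takes values in $\mathbb{Z}_+$: $\eta(0)$ has a given distribution; given $\eta(t)$, set $\rho(t):=\mathbb{P}(\eta(t)>0)$, let $N_{t+1}$ be Poisson with mean $\rho(t)$ (mean $0$ meaning identically $0$), independent of everything before, and set $\eta(t+1):=\eta(t)-\mathbf{1}(\eta(t)>0)+N_{t+1}$. The M/D/1 queue with arrival rate $\rho\ge 0$ is the Markov chain on $\mathbb{Z}_+$ given by $\zeta(t+1):=\zeta(t)-\mathbf{1}(\zeta(t)>0)+M_{t+1}$ with $(M_t)_{t\ge1}$ i.i.d. Poisson of mean $\rho$. For $\rho\in[0,1)$ it is positive recurrent, and $\pi_\rho$ denotes its invariant probability measure on $\mathbb{Z}_+$; its characteristic function is $\hat\pi_\rho(x)=\frac{(1-\rho)(e^{ix}-1)\exp\{\rho(e^{ix}-1)\}}{e^{ix}-\exp\{\rho(e^{ix}-1)\}}$, and for $r\ge0$ the measure $\pi_{\rho_r}$ with $\rho_r=1+r-\sqrt{1+r^2}$ has mean $r$. *)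

(* Defs.v *)
From Stdlib Require Import Reals Arith.
Open Scope R_scope.

Definition is_pmf (p : nat -> R) : Prop :=
  (forall k, 0 <= p k) /\ infinite_sum p 1.

(* Poisson(m) mass at k; for m = 0 this is the Dirac mass at 0 (0^0 = 1). *)
Definition poisson (m : R) (k : nat) : R :=
  exp (- m) * m ^ k / INR (Factorial.fact k).

(* law of x - 1(x>0) when x has law p *)
Definition dec_law (p : nat -> R) (j : nat) : R :=
  match j with
  | O => p 0%nat + p 1%nat
  | S _ => p (S j)
  end.

(* law of x - 1(x>0) + N, with N ~ Poisson(m) independent of x ~ p *)
Definition step (m : R) (p : nat -> R) (k : nat) : R :=
  sum_f_R0 (fun j => dec_law p j * poisson m (k - j)) k.

(* Law of eta(t) for the nonlinear process started from law p0:
   rho(t) = P(eta(t) > 0) = 1 - P(eta(t) = 0). *)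
Fixpoint nl_law (p0 : nat -> R) (t : nat) : nat -> R :=
  match t with
  | O => p0
  | S t' => let p := nl_law p0 t' in step (1 - p 0%nat) p
  end.

Definition MD1_invariant (rho : R) (pi : nat -> R) : Prop :=
  is_pmf pi /\ forall k, step rho pi k = pi k.

(* convergence in distribution of laws on Z_+ (pointwise convergence of
   the mass functions to a probability mass function) *)
Definition conv_in_law (p : nat -> nat -> R) (pi : nat -> R) : Prop :=
  forall k, Un_cv (fun t => p t k) (pi k).

Definition rho_r (r : R) : R := 1 + r - sqrt (1 + r ^ 2).

(* Main.v *)
(* Write F_p for the distribution function of p.  One step of the queue shifts F_p
   by one site and convolves it with a Poisson law.  For two nonlinear laws with
   the same mean, the l^1 distance of the distribution functions is nonincreasing:
   the mass lost by the shift, |F_p(0) - F_q(0)|, equals the difference of the two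
   arrival rates.  Moreover the positive and negative parts of the new difference
   overlap, because Poisson laws have full support, so the decrease is strict, and
   uniform as long as the distance is at least eps and exponential moments are
   bounded; the latter holds since the arrival rates never exceed r < 1.  Comparing
   the laws at times t and t + s shows that the orbit is Cauchy, hence converges to
   a fixed point, which is an M/D/1 invariant law.  Its rate is identified through
   the second moment, which is bounded and has increments
   2 rho - rho^2 - 2 r (1 - rho), and the invariant law of a given rate is unique
   because its recursion determines it from the mass at 0. *)

Require Import Defs.
From Stdlib Require Import Reals Lra Lia Psatz.
From Coquelicot Require Import Coquelicot.
Open Scope R_scope.

(** * Series of real numbers *)

Lemma is_series_eq (a b : nat -> R) (la lb : R) :
  is_series a la -> (forall n, a n = b n) -> la = lb -> is_series b lb.
Proof.
intros Ha Hab <-. now apply is_series_ext with a.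
Qed.

Lemma is_series_addR (a b : nat -> R) (la lb : R) :
  is_series a la -> is_series b lb -> is_series (fun n => a n + b n) (la + lb).
Proof. exact (is_series_plus a b la lb). Qed.

Lemma is_series_mulR (c : R) (a : nat -> R) (la : R) :
  is_series a la -> is_series (fun n => c * a n) (c * la).
Proof. exact (is_series_scal c a la). Qed.

Lemma is_series_subR (a b : nat -> R) (la lb : R) :
  is_series a la -> is_series b lb -> is_series (fun n => a n - b n) (la - lb).
Proof. exact (is_series_minus a b la lb). Qed.

Lemma is_series_consR (a b : nat -> R) (l la : R) :
  is_series b l -> (forall k, a (S k) = b k) -> la = a 0%nat + l ->
  is_series a la.
Proof.
intros H Hab ->. apply is_series_decr_1.
apply is_series_eq with (1 := H); [now intros; rewrite Hab|].
unfold plus, opp; simpl; ring.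
Qed.

Lemma is_series_tailR (a : nat -> R) (l : R) :
  is_series a l -> is_series (fun k => a (S k)) (l - a 0%nat).
Proof.
intros H. apply is_series_incr_1.
apply is_series_eq with (1 := H); [reflexivity|].
unfold plus; simpl; ring.
Qed.

Lemma is_series_lim (a : nat -> R) (l : R) :
  is_series a l <-> is_lim_seq (sum_f_R0 a) l.
Proof.
rewrite is_series_Reals, is_lim_seq_Reals. reflexivity.
Qed.

Lemma is_series_leR (a b : nat -> R) (la lb : R) :
  (forall n, a n <= b n) -> is_series a la -> is_series b lb -> la <= lb.
Proof.
intros Hab Ha Hb. apply is_series_lim in Ha. apply is_series_lim in Hb.
apply (is_lim_seq_le (sum_f_R0 a) (sum_f_R0 b) la lb); trivial.
intros n. apply sum_Rle. intros; apply Hab.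
Qed.

Lemma is_series_eq_val (a : nat -> R) (la lb : R) :
  is_series a la -> is_series a lb -> la = lb.
Proof.
intros Ha Hb. apply Rle_antisym; eapply is_series_leR; eauto; intros; lra.
Qed.

Lemma partial_sum_le (a : nat -> R) (l : R) (n : nat) :
  (forall k, 0 <= a k) -> is_series a l -> sum_f_R0 a n <= l.
Proof.
intros Ha H. apply sum_incr; trivial. now apply is_series_Reals in H.
Qed.

Lemma term_le_series (a : nat -> R) (l : R) (n : nat) :
  (forall k, 0 <= a k) -> is_series a l -> a n <= l.
Proof.
intros Ha H. apply Rle_trans with (2 := partial_sum_le a l n Ha H).
destruct n; simpl; [lra|].
assert (0 <= sum_f_R0 a n) by (apply cond_pos_sum; trivial). lra.
Qed.

Lemma ex_series_abs_dom (a b : nat -> R) :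
  (forall n, Rabs (a n) <= b n) -> ex_series b -> ex_series a.
Proof. intros H Hb. exact (ex_series_le a b H Hb). Qed.

Lemma geometric_series (B y : R) :
  0 <= y < 1 -> is_series (fun k => B * y ^ k) (B / (1 - y)).
Proof.
intros Hy. apply is_series_mulR. apply is_series_geom.
rewrite Rabs_pos_eq; lra.
Qed.

(** Partial sums of the nonnegative series [B * y ^ k - w k] stay below its total; rearranged, this
    bounds the remainder of [w]. *)
Lemma geometric_tail (w : nat -> R) (l B y : R) (K : nat) :
  0 <= y < 1 -> is_series w l -> (forall k, w k <= B * y ^ k) ->
  l - sum_f_R0 w K <= B * y ^ S K / (1 - y).
Proof.
intros Hy Hw Hb.
assert (H := is_series_subR _ _ _ _ (geometric_series B y Hy) Hw).
assert (H2 : sum_f_R0 (fun k => B * y ^ k - w k) K <= B / (1 - y) - l).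
{ apply partial_sum_le; trivial. intros k. specialize (Hb k). lra. }
rewrite minus_sum in H2.
assert (H3 : sum_f_R0 (fun k => B * y ^ k) K = B * ((1 - y ^ S K) / (1 - y))).
{ rewrite <- tech3 by lra. rewrite scal_sum. apply sum_eq; intros; ring. }
rewrite H3 in H2.
replace (B * y ^ S K / (1 - y)) with
  (B / (1 - y) - B * ((1 - y ^ S K) / (1 - y))) by (field; lra).
lra.
Qed.

(** * Convolution on the nonnegative integers *)

Definition conv (a b : nat -> R) (k : nat) : R :=
  sum_f_R0 (fun j => a j * b (k - j)%nat) k.

Lemma conv_series (a b : nat -> R) (la lb : R) :
  (forall k, 0 <= a k) -> (forall k, 0 <= b k) ->
  is_series a la -> is_series b lb -> is_series (conv a b) (la * lb).
Proof.
intros Pa Pb Ha Hb. apply is_series_mult; trivial.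
- exists la. apply is_series_eq with (1 := Ha); trivial.
  intros n; now rewrite Rabs_pos_eq.
- exists lb. apply is_series_eq with (1 := Hb); trivial.
  intros n; now rewrite Rabs_pos_eq.
Qed.

Lemma conv_nonneg (a b : nat -> R) (k : nat) :
  (forall k, 0 <= a k) -> (forall k, 0 <= b k) -> 0 <= conv a b k.
Proof.
intros Pa Pb. apply cond_pos_sum. intros n. now apply Rmult_le_pos.
Qed.

Lemma sum_reverse (f : nat -> R) (n : nat) :
  sum_f_R0 f n = sum_f_R0 (fun j => f (n - j)%nat) n.
Proof.
induction n as [|n IH]; trivial.
rewrite (decomp_sum (fun j => f (S n - j)%nat)) by lia.
rewrite tech5, IH. simpl. ring.
Qed.

Lemma conv_comm (a b : nat -> R) (k : nat) : conv a b k = conv b a k.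
Proof.
unfold conv. rewrite sum_reverse. apply sum_eq. intros i Hi.
replace (k - (k - i))%nat with i by lia. ring.
Qed.

(** Summation is convolution with a constant sequence, so it can be moved onto one factor. This
    turns convolutions of laws into statements on distribution functions. *)
Lemma sum_conv (a b : nat -> R) (k : nat) :
  sum_f_R0 (conv a b) k = conv a (sum_f_R0 b) k.
Proof.
induction k as [|k IH]; [reflexivity|].
rewrite tech5, IH. unfold conv. rewrite !tech5, Nat.sub_diag.
rewrite <- Rplus_assoc, <- plus_sum. f_equal.
apply sum_eq. intros i Hi. replace (S k - i)%nat with (S (k - i)) by lia.
rewrite tech5. ring.
Qed.

Lemma conv_sub_l (a a' b : nat -> R) (k : nat) :
  conv a b k - conv a' b k = conv (fun j => a j - a' j) b k.
Proof.
unfold conv. rewrite <- minus_sum. apply sum_eq; intros; ring.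
Qed.

(** * Poisson laws *)

Lemma poisson_nonneg (m : R) (k : nat) : 0 <= m -> 0 <= poisson m k.
Proof.
intros Hm. unfold poisson, Rdiv. apply Rmult_le_pos.
- apply Rmult_le_pos; [left; apply exp_pos | now apply pow_le].
- left. apply Rinv_0_lt_compat, INR_fact_lt_0.
Qed.

Lemma poisson_pgf (m z : R) :
  is_series (fun k => z ^ k * poisson m k) (exp (m * (z - 1))).
Proof.
assert (H := is_exp_Reals (m * z)). apply is_pseries_R in H.
apply (is_series_mulR (exp (- m))) in H.
apply is_series_eq with (1 := H).
- intros k. unfold poisson. rewrite Rpow_mult_distr. field. apply INR_fact_neq_0.
- rewrite <- exp_plus. f_equal; ring.
Qed.

Lemma poisson_succ (m : R) (k : nat) :
  INR (S k) * poisson m (S k) = m * poisson m k.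
Proof.
unfold poisson. rewrite fact_simpl, mult_INR. simpl pow. field.
split; [apply INR_fact_neq_0 | apply not_0_INR; lia].
Qed.

Lemma poisson_total (m : R) : is_series (poisson m) 1.
Proof.
apply is_series_eq with (1 := poisson_pgf m 1).
- intros n. rewrite pow1. ring.
- rewrite Rminus_diag, Rmult_0_r. apply exp_0.
Qed.

Lemma poisson_mean (m : R) : is_series (fun k => INR k * poisson m k) m.
Proof.
apply is_series_consR with (1 := is_series_mulR m _ _ (poisson_total m)).
- intros k. apply poisson_succ.
- simpl; ring.
Qed.

Lemma poisson_second_moment (m : R) :
  is_series (fun k => INR k ^ 2 * poisson m k) (m + m ^ 2).
Proof.
apply is_series_consR with (1 := is_series_mulR m _ _
    (is_series_addR _ _ _ _ (poisson_mean m) (poisson_total m))).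
- intros n. replace (INR (S n) ^ 2 * poisson m (S n))
    with (INR (S n) * (INR (S n) * poisson m (S n))) by ring.
  rewrite poisson_succ, S_INR. ring.
- simpl. ring.
Qed.

(** A bound uniform in [s] and [j]: [exp (- s)] is at least [exp (-1)], powers of [a <= 1] decrease
    with the exponent, and factorials increase. *)
Lemma poisson_lower_bound (a s : R) (j K : nat) :
  0 <= a <= s -> s <= 1 -> (j <= K)%nat ->
  exp (-1) * a ^ K / INR (Factorial.fact K) <= poisson s j.
Proof.
intros [H0 H1] H2 H3. unfold poisson, Rdiv.
assert (exp (-1) <= exp (- s)).
{ destruct (Rle_lt_or_eq_dec s 1 H2) as [?| ->]; [|right; f_equal; lra].
  left; apply exp_increasing; lra. }
assert (a ^ K <= s ^ j).
{ apply Rle_trans with (a ^ j); [|apply pow_incr; lra].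
  replace K with (j + (K - j))%nat by lia. rewrite pow_add.
  assert (0 <= a ^ j) by now apply pow_le.
  assert (a ^ (K - j) <= 1).
  { rewrite <- (pow1 (K - j)). apply pow_incr; lra. }
  nra. }
assert (0 < exp (-1)) by apply exp_pos.
assert (0 <= a ^ K) by now apply pow_le.
apply Rmult_le_compat.
- nra.
- left. apply Rinv_0_lt_compat, INR_fact_lt_0.
- apply Rmult_le_compat; lra.
- apply Rinv_le_contravar; [apply INR_fact_lt_0|].
  apply le_INR, Factorial.fact_le; lia.
Qed.

(** For [k > 0] the derivative of [poisson m k] in [m] is [poisson m (k - 1) - poisson m k], so the
    sum telescopes. *)
Lemma poisson_cdf_derivative (n : nat) (s : R) :
  is_derive (fun m => sum_f_R0 (poisson m) n) s (- poisson s n).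
Proof.
assert (Hp : forall k, is_derive (fun m => poisson m k) s
  (match k with O => - poisson s 0 | S j => poisson s j - poisson s (S j) end)).
{ intros k. unfold poisson. auto_derive; [trivial|].
  destruct k as [|k].
  - simpl. field.
  - rewrite fact_simpl, mult_INR. simpl pow. simpl Nat.pred.
    field. split; [apply INR_fact_neq_0 | apply not_0_INR; lia]. }
induction n as [|n IH].
- apply (Hp 0%nat).
- eapply is_derive_ext with (f := fun m => sum_f_R0 (poisson m) n + poisson m (S n)).
  + reflexivity.
  + replace (- poisson s (S n)) with
      (- poisson s n + (poisson s n - poisson s (S n))) by ring.
    apply (is_derive_plus (fun m => sum_f_R0 (poisson m) n)
      (fun m => poisson m (S n))); [exact IH | exact (Hp (S n))].
Qed.

Lemma poisson_cdf_decrease (a b : R) (n : nat) :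
  a <= b -> exists c, a <= c <= b /\
  sum_f_R0 (poisson a) n - sum_f_R0 (poisson b) n = (b - a) * poisson c n.
Proof.
intros Hab.
destruct (MVT_gen (fun m => sum_f_R0 (poisson m) n) a b (fun c => - poisson c n))
  as [c [Hc E]].
- intros x _. apply poisson_cdf_derivative.
- intros x _. apply continuity_pt_filterlim.
  apply (ex_derive_continuous (fun m => sum_f_R0 (poisson m) n)).
  eexists. apply poisson_cdf_derivative.
- rewrite Rmin_left, Rmax_right in Hc by trivial.
  exists c. split; trivial. lra.
Qed.

(** * Moments through one step of the queue *)

(** [g] is the generating function at [z]; for [z > 1] it is an exponential moment. *)
Record has_moments (z : R) (p : nat -> R) (m1 m2 g : R) : Prop := {
  hm_nonneg : forall k, 0 <= p k;
  hm_total : is_series p 1;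
  hm_mean : is_series (fun k => INR k * p k) m1;
  hm_second : is_series (fun k => INR k ^ 2 * p k) m2;
  hm_pgf : is_series (fun k => z ^ k * p k) g }.

Lemma dec_law_nonneg (p : nat -> R) :
  (forall k, 0 <= p k) -> forall k, 0 <= dec_law p k.
Proof.
intros Hp [|k]; simpl; [|apply Hp].
specialize (Hp 0%nat) as H0. specialize (Hp 1%nat). lra.
Qed.

Lemma dec_law_series (f p : nat -> R) (s : R) :
  is_series (fun k => f k * p (S k)) s ->
  is_series (fun k => f k * dec_law p k) (f 0%nat * p 0%nat + s).
Proof.
intros H. apply is_series_tailR in H.
apply is_series_consR with (1 := H); [reflexivity|].
simpl; ring.
Qed.

Lemma sum_dec_law (p : nat -> R) (k : nat) :
  sum_f_R0 (dec_law p) k = sum_f_R0 p (S k).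
Proof.
induction k as [|k IH]; [reflexivity|].
rewrite tech5, IH. now rewrite (tech5 p (S k)).
Qed.

Lemma cdf_step (m : R) (p : nat -> R) (k : nat) :
  sum_f_R0 (step m p) k = conv (fun j => sum_f_R0 p (S j)) (poisson m) k.
Proof.
change (step m p) with (conv (dec_law p) (poisson m)).
rewrite (sum_eq _ (conv (poisson m) (dec_law p)))
  by (intros; apply conv_comm).
rewrite sum_conv, conv_comm. unfold conv.
apply sum_eq; intros. now rewrite sum_dec_law.
Qed.

Lemma dec_law_moments (z : R) (p : nat -> R) (m1 m2 g : R) :
  z <> 0 -> has_moments z p m1 m2 g ->
  has_moments z (dec_law p) (m1 - (1 - p 0%nat))
    (m2 - 2 * m1 + (1 - p 0%nat)) (p 0%nat + (g - p 0%nat) / z).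
Proof.
intros Hz [Hn Ht H1 H2 Hg].
apply is_series_tailR in Ht, H1, H2, Hg.
split.
- now apply dec_law_nonneg.
- eapply is_series_eq.
  + apply (dec_law_series (fun _ => 1) p).
    apply (is_series_mulR 1) in Ht. exact Ht.
  + intros; simpl; ring.
  + simpl; ring.
- eapply is_series_eq.
  + apply (dec_law_series INR p).
    apply is_series_eq with (1 := is_series_subR _ _ _ _ H1 Ht); [|reflexivity].
    intros n. rewrite S_INR. ring.
  + reflexivity.
  + simpl; ring.
- eapply is_series_eq.
  + apply (dec_law_series (fun k => INR k ^ 2) p).
    apply is_series_eq with (1 := is_series_addR _ _ _ _
      (is_series_subR _ _ _ _ H2 (is_series_mulR 2 _ _ H1)) Ht); [|reflexivity].
    intros n. rewrite S_INR. ring.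
  + reflexivity.
  + simpl; ring.
- eapply is_series_eq.
  + apply (dec_law_series (fun k => z ^ k) p).
    apply is_series_eq with (1 := is_series_mulR (/ z) _ _ Hg); [|reflexivity].
    intros n. simpl. now field.
  + reflexivity.
  + simpl. now field.
Qed.

(** Independence: generating functions multiply, and powers of [INR k] are expanded after splitting
    [k] as [i + (k - i)] inside the convolution. *)
Lemma step_moments (m z : R) (p : nat -> R) (m1 m2 g : R) :
  0 <= m -> 0 < z -> has_moments z p m1 m2 g ->
  has_moments z (step m p) (m1 - (1 - p 0%nat) + m)
    (m2 - 2 * m1 + (1 - p 0%nat) + 2 * m * (m1 - (1 - p 0%nat)) + m + m ^ 2)
    ((p 0%nat + (g - p 0%nat) / z) * exp (m * (z - 1))).
Proof.
intros Hm Hz Hp.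
apply dec_law_moments in Hp; [|lra].
destruct Hp as [Dn Dt D1 D2 Dg].
change (step m p) with (conv (dec_law p) (poisson m)).
assert (Pn : forall k, 0 <= poisson m k) by (intros; now apply poisson_nonneg).
assert (W : forall f : nat -> R, (forall k, 0 <= f k) ->
  forall q : nat -> R, (forall k, 0 <= q k) -> forall k, 0 <= f k * q k)
  by (intros; now apply Rmult_le_pos).
assert (WI : forall k, 0 <= INR k) by (intros; apply pos_INR).
assert (WI2 : forall k, 0 <= INR k ^ 2) by (intros; apply pow2_ge_0).
assert (Wz : forall k, 0 <= z ^ k) by (intros; apply pow_le; lra).
split.
- intros k. now apply conv_nonneg.
- eapply is_series_eq.
  + apply (conv_series _ _ _ _ Dn Pn Dt (poisson_total m)).
  + reflexivity.
  + ring.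
- eapply is_series_eq.
  + apply is_series_addR.
    * apply (conv_series _ _ _ _ (W _ WI _ Dn) Pn D1 (poisson_total m)).
    * apply (conv_series _ _ _ _ Dn (W _ WI _ Pn) Dt (poisson_mean m)).
  + intros k. cbv beta. unfold conv. rewrite <- plus_sum, scal_sum.
    apply sum_eq. intros i Hi.
    replace (INR k) with (INR i + INR (k - i)) by (rewrite <- plus_INR; f_equal; lia).
    ring.
  + ring.
- eapply is_series_eq.
  + apply is_series_addR; [apply is_series_addR|].
    * apply (conv_series _ _ _ _ (W _ WI2 _ Dn) Pn D2 (poisson_total m)).
    * apply (is_series_mulR 2).
      apply (conv_series _ _ _ _ (W _ WI _ Dn) (W _ WI _ Pn) D1 (poisson_mean m)).
    * apply (conv_series _ _ _ _ Dn (W _ WI2 _ Pn) Dt (poisson_second_moment m)).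
  + intros k. cbv beta. unfold conv. rewrite !scal_sum, <- !plus_sum.
    apply sum_eq. intros i Hi.
    replace (INR k) with (INR i + INR (k - i)) by (rewrite <- plus_INR; f_equal; lia).
    ring.
  + ring.
- eapply is_series_eq.
  + apply (conv_series _ _ _ _ (W _ Wz _ Dn) (W _ Wz _ Pn) Dg (poisson_pgf m z)).
  + intros k. cbv beta. unfold conv. rewrite scal_sum.
    apply sum_eq. intros i Hi.
    replace (z ^ k) with (z ^ i * z ^ (k - i)) by (rewrite <- pow_add; f_equal; lia).
    ring.
  + ring.
Qed.

(** * Tails and moment inequalities *)

Definition tail (p : nat -> R) (k : nat) : R := 1 - sum_f_R0 p k.

Lemma tail_nonneg (p : nat -> R) (k : nat) :
  (forall k, 0 <= p k) -> is_series p 1 -> 0 <= tail p k.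
Proof.
intros Hn Ht. unfold tail. assert (H := partial_sum_le p 1 k Hn Ht). lra.
Qed.

(** Markov's inequality on the sites beyond [k]. The right side is the remainder of the series, not
    its total, which is what controls the boundary term of [sum_tail]. *)
Lemma weighted_tail_le (f p : nat -> R) (s : R) (k : nat) :
  (forall k, 0 <= p k) -> is_series p 1 ->
  (forall i j, (i <= j)%nat -> f i <= f j) ->
  is_series (fun k => f k * p k) s ->
  f (S k) * tail p k <= s - sum_f_R0 (fun k => f k * p k) k.
Proof.
intros Hn Ht Hf Hs.
assert (A : forall a l, is_series a l ->
   is_series (fun i => a (S k + i)%nat) (l - sum_f_R0 a k)).
{ intros a l Ha. apply is_series_incr_n; [lia|].
  apply is_series_eq with (1 := Ha); trivial.
  rewrite sum_n_Reals.
  assert (E : l - sum_f_R0 a k + sum_f_R0 a k = l) by ring.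
  symmetry; exact E. }
apply A in Ht, Hs. apply (is_series_mulR (f (S k))) in Ht.
apply is_series_leR with (2 := Ht) (3 := Hs).
intros n. apply Rmult_le_compat_r; trivial. apply Hf. lia.
Qed.

(** Summation by parts, with its boundary term. *)
Lemma sum_tail (p : nat -> R) (n : nat) :
  sum_f_R0 (tail p) n =
  sum_f_R0 (fun k => INR k * p k) n + INR (S n) * tail p n.
Proof.
induction n as [|n IH].
- unfold tail; simpl; ring.
- rewrite tech5, IH, tech5. unfold tail. rewrite tech5, !S_INR. ring.
Qed.

Lemma tail_series (p : nat -> R) (m1 : R) :
  (forall k, 0 <= p k) -> is_series p 1 ->
  is_series (fun k => INR k * p k) m1 -> is_series (tail p) m1.
Proof.
intros Hn Ht H1. apply is_series_lim.
apply is_lim_seq_le_le with (u := sum_f_R0 (fun k => INR k * p k))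
  (w := fun _ => m1).
- intros n. rewrite sum_tail. split.
  + assert (0 <= tail p n) by now apply tail_nonneg.
    assert (0 <= INR (S n)) by apply pos_INR. nra.
  + assert (H := weighted_tail_le INR p m1 n Hn Ht
      (fun i j Hij => le_INR i j Hij) H1). lra.
- now apply is_series_lim.
- apply is_lim_seq_const.
Qed.

Lemma tail_geometric (z : R) (p : nat -> R) (m1 m2 g : R) (k : nat) :
  1 <= z -> has_moments z p m1 m2 g -> tail p k <= g * (/ z) ^ k.
Proof.
intros Hz [Hn Ht _ _ Hg].
assert (H : z ^ S k * tail p k <= g - sum_f_R0 (fun k => z ^ k * p k) k).
{ apply weighted_tail_le; trivial. intros; now apply Rle_pow. }
assert (H1 : 0 <= sum_f_R0 (fun k => z ^ k * p k) k).
{ apply cond_pos_sum. intros n. apply Rmult_le_pos; trivial. apply pow_le; lra. }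
assert (H2 : 0 <= tail p k) by now apply tail_nonneg.
assert (H3 : 0 < z ^ k) by (apply pow_lt; lra).
rewrite pow_inv. apply Rmult_le_reg_r with (z ^ k); trivial.
rewrite Rmult_assoc, Rinv_l by lra.
simpl in H. assert (0 <= z ^ k * tail p k) by nra. nra.
Qed.

(** Markov's inequality at level 1. It caps the arrival rate by the conserved mean. *)
Lemma occupation_le_mean (z : R) (p : nat -> R) (m1 m2 g : R) :
  has_moments z p m1 m2 g -> 0 <= 1 - p 0%nat <= m1.
Proof.
intros [Hn Ht H1 _ _]. split.
- assert (H := term_le_series p 1 0 Hn Ht). lra.
- apply is_series_tailR in Ht, H1.
  apply is_series_leR with (2 := Ht) (lb := m1) (b := fun k => INR (S k) * p (S k)).
  + intros n. rewrite S_INR. assert (0 <= INR n) by apply pos_INR.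
    specialize (Hn (S n)). nra.
  + apply is_series_eq with (1 := H1); trivial. simpl; ring.
Qed.

(** Cauchy-Schwarz for [X] and the indicator of [X > 0]; it keeps the arrival rate away from 0. It
    follows from the expectation of [(X - c) ^ 2] on [X > 0] being nonnegative. *)
Lemma mean_sq_le_occupation (z : R) (p : nat -> R) (m1 m2 g M : R) :
  has_moments z p m1 m2 g -> 0 < m1 -> 0 < M -> m2 <= M ->
  m1 ^ 2 <= M * (1 - p 0%nat).
Proof.
intros [Hn Ht H1 H2 _] Hm HM HmM.
apply is_series_tailR in Ht, H1, H2. change (INR 0) with 0 in H1, H2.
(* This value makes the cross term [2 * c * m1] equal to [2 * M], so that [m2 <= M] leaves
   [M <= c ^ 2 * (1 - p 0)]. *)
set (c := M / m1).
assert (H : 0 <= (m2 - 0 ^ 2 * p 0%nat) - (2 * c) * (m1 - 0 * p 0%nat)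
                 + c ^ 2 * (1 - p 0%nat)).
{ apply is_series_leR with (a := fun _ => 0 * 0) (b := fun k =>
    (INR (S k) - c) ^ 2 * p (S k)).
  - intros n. rewrite Rmult_0_l. apply Rmult_le_pos; [apply pow2_ge_0 | apply Hn].
  - apply is_series_eq with (1 := geometric_series 0 0 ltac:(lra));
      intros; lra.
  - eapply is_series_eq.
    + apply is_series_addR; [apply is_series_subR|].
      * exact H2.
      * apply (is_series_mulR (2 * c)). exact H1.
      * apply (is_series_mulR (c ^ 2)). exact Ht.
    + intros k. cbv beta. ring.
    + reflexivity. }
assert (E : c * m1 = M) by (unfold c; field; lra).
assert (Hc : 0 < c) by (unfold c; now apply Rdiv_lt_0_compat).
assert (H0 : M <= c ^ 2 * (1 - p 0%nat)) by nra.
assert (m1 ^ 2 * M <= (c * m1) ^ 2 * (1 - p 0%nat)).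
{ replace ((c * m1) ^ 2 * (1 - p 0%nat)) with
    (m1 ^ 2 * (c ^ 2 * (1 - p 0%nat))) by ring.
  apply Rmult_le_compat_l; trivial. apply pow2_ge_0. }
rewrite E in H3. nra.
Qed.

(** * Contraction of the Wasserstein distance *)

(** Averages [poisson_cdf_decrease] over the position after the departure. Every term is
    nonnegative, and the one at site 0 already gives the bound. *)
Lemma cdf_step_decrease (a b mu : R) (q : nat -> R) (K : nat) :
  (forall k, 0 <= q k) -> 0 <= b <= a -> 0 <= mu ->
  (forall s, b <= s <= a -> mu <= poisson s K) ->
  q 0%nat * ((a - b) * mu) <= sum_f_R0 (step b q) K - sum_f_R0 (step a q) K.
Proof.
intros Hq Hba Hmu Hs.
assert (Hd := dec_law_nonneg q Hq).
change (step b q) with (conv (dec_law q) (poisson b)).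
change (step a q) with (conv (dec_law q) (poisson a)).
rewrite !sum_conv. unfold conv. rewrite <- minus_sum.
set (h := fun j => _).
assert (Hh : forall j, 0 <= h j).
{ intros j. unfold h. rewrite <- Rmult_minus_distr_l.
  apply Rmult_le_pos; [apply Hd|].
  destruct (poisson_cdf_decrease b a (K - j)) as [c [Hc ->]]; [lra|].
  apply Rmult_le_pos; [lra|]. apply poisson_nonneg; lra. }
apply Rle_trans with (h 0%nat).
- unfold h. rewrite <- Rmult_minus_distr_l, Nat.sub_0_r.
  destruct (poisson_cdf_decrease b a K) as [c [Hc ->]]; [lra|].
  assert (q 0%nat <= dec_law q 0) by (simpl; specialize (Hq 1%nat); lra).
  apply Rmult_le_compat; trivial.
  + apply Rmult_le_pos; lra.
  + apply Rmult_le_compat_l; [lra | now apply Hs].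
- destruct K as [|K]; [simpl; lra|].
  rewrite decomp_sum by lia.
  assert (0 <= sum_f_R0 (fun i => h (S i)) (Nat.pred (S K)))
    by (apply cond_pos_sum; intros; apply Hh).
  lra.
Qed.

(* The Wasserstein-1 distance: on Z_+ it is the l^1 distance of the
   distribution functions. *)
Definition wdist (p q : nat -> R) : R :=
  Series (fun k => Rabs (sum_f_R0 p k - sum_f_R0 q k)).

Lemma wdist_sym (p q : nat -> R) : wdist p q = wdist q p.
Proof. apply Series_ext. intros n. apply Rabs_minus_sym. Qed.

(** The difference is [tail q k - tail p k] with both tails nonnegative, so the larger one dominates
    it. *)
Lemma cdf_diff_le_tails (z : R) (p q : nat -> R) (m1 m2 g m1' m2' g' : R) (k : nat) :
  has_moments z p m1 m2 g -> has_moments z q m1' m2' g' ->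
  Rabs (sum_f_R0 p k - sum_f_R0 q k) <= Rmax (tail p k) (tail q k).
Proof.
intros Hp Hq.
assert (0 <= tail p k) by (apply tail_nonneg; apply Hp).
assert (0 <= tail q k) by (apply tail_nonneg; apply Hq).
unfold tail in *.
apply Rabs_le. split.
- apply Rle_trans with (- (1 - sum_f_R0 p k)); [|lra].
  apply Ropp_le_contravar, Rmax_l.
- apply Rle_trans with (1 - sum_f_R0 q k); [lra | apply Rmax_r].
Qed.

(** [Series] has a value even for divergent series, so convergence is established here: the terms
    are dominated by the two tails, whose totals are the means. *)
Lemma wdist_series (z : R) (p q : nat -> R) (m1 m2 g m1' m2' g' : R) :
  has_moments z p m1 m2 g -> has_moments z q m1' m2' g' ->
  is_series (fun k => Rabs (sum_f_R0 p k - sum_f_R0 q k)) (wdist p q) /\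
  wdist p q <= m1 + m1'.
Proof.
intros Hp Hq.
assert (HT := is_series_addR _ _ _ _
  (tail_series p m1 (hm_nonneg _ _ _ _ _ Hp) (hm_total _ _ _ _ _ Hp)
     (hm_mean _ _ _ _ _ Hp))
  (tail_series q m1' (hm_nonneg _ _ _ _ _ Hq) (hm_total _ _ _ _ _ Hq)
     (hm_mean _ _ _ _ _ Hq))).
assert (D : forall k, Rabs (sum_f_R0 p k - sum_f_R0 q k) <= tail p k + tail q k).
{ intros k. apply Rle_trans with (1 := cdf_diff_le_tails _ _ _ _ _ _ _ _ _ k Hp Hq).
  assert (0 <= tail p k) by (apply tail_nonneg; apply Hp).
  assert (0 <= tail q k) by (apply tail_nonneg; apply Hq).
  apply Rmax_lub; lra. }
assert (HS : is_series (fun k => Rabs (sum_f_R0 p k - sum_f_R0 q k)) (wdist p q)).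
{ apply Series_correct. apply ex_series_abs_dom with (2 := ex_intro _ _ HT).
  intros n. rewrite Rabs_Rabsolu. apply D. }
split; trivial.
now apply is_series_leR with (1 := D) (2 := HS).
Qed.

(** Positive part of the difference of the distribution functions, read one site to the right
    because of the departure shift; [excess q p] is the negative part. *)
Definition excess (p q : nat -> R) (k : nat) : R :=
  (Rabs (sum_f_R0 q (S k) - sum_f_R0 p (S k))
   + (sum_f_R0 q (S k) - sum_f_R0 p (S k))) / 2.

Lemma excess_nonneg (p q : nat -> R) (k : nat) : 0 <= excess p q k.
Proof.
unfold excess.
assert (H := Rle_abs (- (sum_f_R0 q (S k) - sum_f_R0 p (S k)))).
rewrite Rabs_Ropp in H. lra.
Qed.

(** Equal means make the signed difference sum to 0, so its two parts weigh [wdist p q / 2] each.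
    Dropping site 0 costs only the part where [q] is ahead. *)
Lemma excess_series (z : R) (p q : nat -> R) (m1 m2 g m2' g' : R) :
  has_moments z p m1 m2 g -> has_moments z q m1 m2' g' -> p 0%nat <= q 0%nat ->
  is_series (excess p q) (wdist p q / 2 - (q 0%nat - p 0%nat)) /\
  is_series (excess q p) (wdist p q / 2).
Proof.
intros Hp Hq Hpq.
destruct (wdist_series _ _ _ _ _ _ _ _ _ Hp Hq) as [HS _].
assert (HT := is_series_subR _ _ _ _
  (tail_series p m1 (hm_nonneg _ _ _ _ _ Hp) (hm_total _ _ _ _ _ Hp)
     (hm_mean _ _ _ _ _ Hp))
  (tail_series q m1 (hm_nonneg _ _ _ _ _ Hq) (hm_total _ _ _ _ _ Hq)
     (hm_mean _ _ _ _ _ Hq))).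
apply is_series_tailR in HS, HT.
unfold tail in HT.
change (sum_f_R0 p 0) with (p 0%nat) in HS, HT.
change (sum_f_R0 q 0) with (q 0%nat) in HS, HT.
rewrite (Rabs_left1 (p 0%nat - q 0%nat)) in HS by lra.
split.
- apply is_series_eq with (1 := is_series_mulR (/ 2) _ _
    (is_series_addR _ _ _ _ HS HT)).
  + intros n. unfold excess. rewrite Rabs_minus_sym. field.
  + field.
- apply is_series_eq with (1 := is_series_mulR (/ 2) _ _
    (is_series_subR _ _ _ _ HS HT)).
  + intros n. unfold excess. field.
  + field.
Qed.

(* With [H] the difference of the distribution functions, the new difference is
   [U + Y - W]: [U] and [W] come from the positive and negative parts of the
   shifted [H], and [Y >= 0] from the difference of the two arrival rates.  The
   masses of [U + Y + W] add up to [wdist p q], and any overlap of [U + Y] with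
   [W] is lost twice. *)
Lemma wdist_step (z : R) (p q : nat -> R) (m1 m2 g m2' g' c : R) (K : nat) :
  0 < z -> has_moments z p m1 m2 g -> has_moments z q m1 m2' g' ->
  p 0%nat <= q 0%nat ->
  c <= conv (excess q p) (poisson (1 - p 0%nat)) K ->
  c <= conv (excess p q) (poisson (1 - p 0%nat)) K
       + (sum_f_R0 (step (1 - q 0%nat) q) K - sum_f_R0 (step (1 - p 0%nat) q) K) ->
  wdist (step (1 - p 0%nat) p) (step (1 - q 0%nat) q) <= wdist p q - 2 * c.
Proof.
intros Hz Hp Hq Hpq Hc1 Hc2.
destruct (excess_series _ _ _ _ _ _ _ _ Hp Hq Hpq) as [E1 E2].
destruct (occupation_le_mean _ _ _ _ _ Hp) as [Ra _].
destruct (occupation_le_mean _ _ _ _ _ Hq) as [Rb _].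
set (a := 1 - p 0%nat) in *. set (b := 1 - q 0%nat) in *.
assert (Sp := step_moments a z p _ _ _ Ra Hz Hp).
assert (Sq := step_moments b z q _ _ _ Rb Hz Hq).
assert (Sqa := step_moments a z q _ _ _ Ra Hz Hq).
fold a in Sp. fold b in Sq, Sqa.
destruct (wdist_series _ _ _ _ _ _ _ _ _ Sp Sq) as [HS _].
assert (Pa : forall k, 0 <= poisson a k) by (intros; now apply poisson_nonneg).
set (Y := fun k => sum_f_R0 (step b q) k - sum_f_R0 (step a q) k) in *.
(* The total of [Y] is [a - b], the difference of the two means after the step; it restores the mass
   [q 0 - p 0] missing from [E1]. *)
assert (HY : is_series Y (q 0%nat - p 0%nat)).
{ apply is_series_eq with (1 := is_series_subR _ _ _ _
   (tail_series _ _ (hm_nonneg _ _ _ _ _ Sqa) (hm_total _ _ _ _ _ Sqa)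
      (hm_mean _ _ _ _ _ Sqa))
   (tail_series _ _ (hm_nonneg _ _ _ _ _ Sq) (hm_total _ _ _ _ _ Sq)
      (hm_mean _ _ _ _ _ Sq))).
  - intros n. unfold Y, tail. ring.
  - unfold a, b. ring. }
assert (Y0 : forall k, 0 <= Y k).
{ intros k.
  assert (H := cdf_step_decrease a b 0 q k (hm_nonneg _ _ _ _ _ Hq)).
  rewrite !Rmult_0_r in H. apply H; try lra.
  - unfold a, b in *; lra.
  - intros s Hs. apply poisson_nonneg; lra. }
assert (HU := conv_series _ _ _ _ (excess_nonneg p q) Pa E1 (poisson_total a)).
assert (HW := conv_series _ _ _ _ (excess_nonneg q p) Pa E2 (poisson_total a)).
set (U := conv (excess p q) (poisson a)) in *.
set (W := conv (excess q p) (poisson a)) in *.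
assert (U0 : forall k, 0 <= U k)
  by (intros; apply conv_nonneg; [apply excess_nonneg | trivial]).
assert (W0 : forall k, 0 <= W k)
  by (intros; apply conv_nonneg; [apply excess_nonneg | trivial]).
assert (D : forall k, sum_f_R0 (step a p) k - sum_f_R0 (step b q) k
                      = W k - (U k + Y k)).
{ intros k. unfold Y.
  assert (sum_f_R0 (step a q) k - sum_f_R0 (step a p) k = U k - W k); [|lra].
  rewrite !cdf_step, conv_sub_l. unfold U, W. rewrite conv_sub_l.
  unfold conv. apply sum_eq. intros i _. unfold excess.
  rewrite (Rabs_minus_sym (sum_f_R0 p (S i))). field. }
(* The loss [U + Y + W - |W - (U + Y)|] is termwise nonnegative and sums to the decrease of the
   distance, so its single term at [K], twice the minimum of [U + Y] and [W], bounds that decrease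
   from below. *)
assert (T := is_series_subR _ _ _ _ (is_series_addR _ _ _ _
   (is_series_addR _ _ _ _ HU HY) HW) HS).
assert (G := fun N => term_le_series _ _ K N T). cbv beta in G.
rewrite D in G. fold (Y K) in Hc2.
assert (L : forall w u y, 0 <= w -> 0 <= u -> 0 <= y -> Rabs (w - (u + y)) <= u + y + w)
  by (intros; unfold Rabs; destruct (Rcase_abs _); lra).
assert (G' : U K + Y K + W K - Rabs (W K - (U K + Y K)) <=
  wdist p q - wdist (step a p) (step b q)).
{ eapply Rle_trans; [apply G | right; field].
  intros k. rewrite D. specialize (L _ _ _ (W0 k) (U0 k) (Y0 k)). lra. }
revert G'. unfold Rabs. destruct (Rcase_abs _); lra.
Qed.

Lemma conv_lower_bound (w b : nat -> R) (mu : R) (K : nat) :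
  (forall k, 0 <= w k) -> (forall j, (j <= K)%nat -> mu <= b j) ->
  mu * sum_f_R0 w K <= conv w b K.
Proof.
intros Hw Hb. unfold conv. rewrite scal_sum.
apply sum_Rle. intros n Hn. apply Rmult_le_compat_l; trivial.
apply Hb. lia.
Qed.

Definition nl_step (p : nat -> R) : nat -> R := step (1 - p 0%nat) p.

(** The premises of [wdist_step] at [c = 0], which yield the plain monotonicity of the distance. *)
Lemma overlap_nonneg (p q : nat -> R) (K : nat) :
  (forall k, 0 <= q k) -> 0 <= 1 - q 0%nat -> p 0%nat <= q 0%nat ->
  0 <= conv (excess q p) (poisson (1 - p 0%nat)) K /\
  0 <= conv (excess p q) (poisson (1 - p 0%nat)) K
       + (sum_f_R0 (step (1 - q 0%nat) q) K - sum_f_R0 (step (1 - p 0%nat) q) K).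
Proof.
intros Hq Hb Hpq.
assert (Pa : forall k, 0 <= poisson (1 - p 0%nat) k)
  by (intros; apply poisson_nonneg; lra).
assert (H := cdf_step_decrease (1 - p 0%nat) (1 - q 0%nat) 0 q K Hq).
rewrite !Rmult_0_r in H.
split; [|apply Rplus_le_le_0_compat].
1, 2: apply conv_nonneg; trivial; apply excess_nonneg.
apply H; try lra. intros s Hs. apply poisson_nonneg; lra.
Qed.

Lemma wdist_nl_step_le (z : R) (p q : nat -> R) (m1 m2 g m2' g' : R) :
  0 < z -> has_moments z p m1 m2 g -> has_moments z q m1 m2' g' ->
  wdist (nl_step p) (nl_step q) <= wdist p q.
Proof.
intros Hz.
(* By symmetry of [wdist], the law with more mass at 0 can be put second. *)
assert (main : forall p q m2 g m2' g', has_moments z p m1 m2 g ->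
  has_moments z q m1 m2' g' -> p 0%nat <= q 0%nat ->
  wdist (nl_step p) (nl_step q) <= wdist p q).
{ clear - Hz. intros p q m2 g m2' g' Hp Hq Hpq.
  destruct (overlap_nonneg p q 0) as [H1 H2]; trivial.
  - apply Hq.
  - apply (occupation_le_mean _ _ _ _ _ Hq).
  - assert (H := wdist_step z p q m1 m2 g m2' g' 0 0 Hz Hp Hq Hpq H1 H2).
    unfold nl_step. lra. }
intros Hp Hq. destruct (Rle_dec (p 0%nat) (q 0%nat)) as [H|H].
- now apply (main p q m2 g m2' g').
- rewrite (wdist_sym p), (wdist_sym (nl_step p)).
  apply (main q p m2' g' m2 g); trivial. lra.
Qed.

Lemma geometric_small (B y eps : R) :
  0 <= y < 1 -> 0 < eps -> exists K, B * y ^ S K / (1 - y) <= eps.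
Proof.
intros Hy He.
(* Adding 1 keeps the denominator positive when [B = 0]. *)
destruct (pow_lt_1_zero y ltac:(rewrite Rabs_pos_eq; lra)
  (eps * (1 - y) / (Rabs B + 1))) as [N HN].
{ assert (0 <= Rabs B) by apply Rabs_pos.
  apply Rdiv_lt_0_compat; [|lra]. apply Rmult_lt_0_compat; lra. }
exists N. specialize (HN (S N) ltac:(lia)).
assert (Hp : 0 <= y ^ S N) by (apply pow_le; lra).
rewrite Rabs_pos_eq in HN by trivial.
assert (HB := Rle_abs B). assert (0 <= Rabs B) by apply Rabs_pos.
apply Rmult_le_reg_r with (1 - y); [lra|].
unfold Rdiv. rewrite Rmult_assoc, Rinv_l, Rmult_1_r by lra.
apply Rle_trans with ((Rabs B + 1) * y ^ S N).
- apply Rmult_le_compat_r; lra.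
- left. apply Rmult_lt_reg_r with (/ (Rabs B + 1)).
  + apply Rinv_0_lt_compat; lra.
  + unfold Rdiv in HN. replace ((Rabs B + 1) * y ^ S N * / (Rabs B + 1))
      with (y ^ S N) by (field; lra). lra.
Qed.

(* Exponential moments confine [p] and [q] to a finite window up to [eps/4], so
   both overlapping parts charge the window's endpoint [K] uniformly. *)
Lemma wdist_nl_step_decrease (z r M B eps : R) :
  1 < z -> r < 1 -> 0 < M -> 0 < eps ->
  exists gam, 0 < gam /\
  forall p q m2 g m2' g', has_moments z p r m2 g -> has_moments z q r m2' g' ->
  m2 <= M -> m2' <= M -> g <= B -> g' <= B ->
  eps <= wdist p q -> wdist (nl_step p) (nl_step q) <= wdist p q - gam.
Proof.
intros Hz Hr HM He.
assert (Hy : 0 < / z < 1).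
{ split; [apply Rinv_0_lt_compat; lra|]. rewrite <- Rinv_1.
  apply Rinv_lt_contravar; lra. }
(* Half of the distance is at least [eps / 2]; a window that loses at most [eps / 4] of it keeps the
   other [eps / 4]. *)
destruct (geometric_small B (/ z) (eps / 4)) as [K HK]; [lra | lra |].
(* Lower bound for both rates: [eps <= wdist p q <= 2 * r] gives [r >= eps / 2], and
   [mean_sq_le_occupation] makes each rate at least [r ^ 2 / M]. *)
set (al := Rmin 1 (eps ^ 2 / (4 * M))).
assert (Hal : 0 < al).
{ apply Rmin_pos; [lra|]. apply Rdiv_lt_0_compat; [nra | lra]. }
set (mu := exp (-1) * al ^ K / INR (Factorial.fact K)).
assert (Hmu : 0 < mu).
{ apply Rdiv_lt_0_compat; [|apply INR_fact_lt_0].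
  apply Rmult_lt_0_compat; [apply exp_pos | now apply pow_lt]. }
(* The factor [1 - r] is a lower bound for [q 0], which multiplies the effect of the rate difference
   in [cdf_step_decrease]. *)
set (c := (1 - r) * (mu * (eps / 4))).
assert (Hc : 0 < c)
  by (apply Rmult_lt_0_compat; [lra | apply Rmult_lt_0_compat; lra]).
exists (2 * c). split; [lra|].
assert (main : forall p q m2 g m2' g', has_moments z p r m2 g ->
  has_moments z q r m2' g' -> p 0%nat <= q 0%nat ->
  m2 <= M -> m2' <= M -> g <= B -> g' <= B ->
  eps <= wdist p q -> wdist (nl_step p) (nl_step q) <= wdist p q - 2 * c).
{ intros p q m2 g m2' g' Hp Hq Hpq Hm2 Hm2' Hg Hg' HV.
  destruct (wdist_series _ _ _ _ _ _ _ _ _ Hp Hq) as [_ Hr2].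
  destruct (excess_series _ _ _ _ _ _ _ _ Hp Hq Hpq) as [E1 E2].
  assert (Ha := occupation_le_mean _ _ _ _ _ Hp).
  assert (Hb := occupation_le_mean _ _ _ _ _ Hq).
  assert (Hbal : al <= 1 - q 0%nat).
  { assert (H := mean_sq_le_occupation _ _ _ _ _ M Hq ltac:(lra) HM Hm2').
    apply Rle_trans with (1 := Rmin_r _ _).
    apply Rmult_le_reg_l with (4 * M); [lra|].
    replace (4 * M * (eps ^ 2 / (4 * M))) with (eps ^ 2) by (field; lra).
    nra. }
  assert (Hpo : forall s j, 1 - q 0%nat <= s <= 1 - p 0%nat -> (j <= K)%nat ->
     mu <= poisson s j).
  { intros s j Hs Hj. apply poisson_lower_bound; trivial; lra. }
  assert (Htail : forall k, Rabs (sum_f_R0 q (S k) - sum_f_R0 p (S k))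
     <= B * (/ z) ^ k).
  { intros k. rewrite Rabs_minus_sym.
    apply Rle_trans with (1 := cdf_diff_le_tails _ _ _ _ _ _ _ _ _ _ Hp Hq).
    assert (T1 := tail_geometric z p _ _ _ (S k) ltac:(lra) Hp).
    assert (T2 := tail_geometric z q _ _ _ (S k) ltac:(lra) Hq).
    assert (T0 := tail_nonneg p (S k) (hm_nonneg _ _ _ _ _ Hp) (hm_total _ _ _ _ _ Hp)).
    assert (Hk : 0 < (/ z) ^ S k) by (apply pow_lt; lra).
    assert (Hk' : (/ z) ^ S k <= (/ z) ^ k).
    { simpl. assert (0 < (/ z) ^ k) by (apply pow_lt; lra). nra. }
    assert (0 <= B) by nra.
    apply Rle_trans with (B * (/ z) ^ S k); [|now apply Rmult_le_compat_l].
    apply Rmax_lub; nra. }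
  assert (W1 := geometric_tail (excess q p) _ B (/ z) K ltac:(lra) E2).
  assert (W2 := geometric_tail (excess p q) _ B (/ z) K ltac:(lra) E1).
  assert (C1 : forall k, excess q p k <= B * (/ z) ^ k).
  { intros k. apply Rle_trans with (2 := Htail k). unfold excess.
    rewrite (Rabs_minus_sym (sum_f_R0 p (S k))).
    assert (H := Rle_abs (sum_f_R0 p (S k) - sum_f_R0 q (S k))).
    rewrite Rabs_minus_sym in H. lra. }
  assert (C2 : forall k, excess p q k <= B * (/ z) ^ k).
  { intros k. apply Rle_trans with (2 := Htail k). unfold excess.
    assert (H := Rle_abs (sum_f_R0 q (S k) - sum_f_R0 p (S k))). lra. }
  specialize (W1 C1). specialize (W2 C2).
  assert (Hab : 1 - q 0%nat <= 1 - p 0%nat <= 1 - p 0%nat) by lra.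
  assert (L1 := conv_lower_bound (excess q p) (poisson (1 - p 0%nat)) mu K
    (excess_nonneg q p) (fun j => Hpo _ j Hab)).
  assert (L2 := conv_lower_bound (excess p q) (poisson (1 - p 0%nat)) mu K
    (excess_nonneg p q) (fun j => Hpo _ j Hab)).
  assert (L3 := cdf_step_decrease (1 - p 0%nat) (1 - q 0%nat) mu q K
    (hm_nonneg _ _ _ _ _ Hq) ltac:(lra) ltac:(lra)
    (fun s Hs => Hpo s K Hs (le_n K))).
  assert (P2 : 0 <= sum_f_R0 (excess p q) K)
    by (apply cond_pos_sum; intros; apply excess_nonneg).
  apply (wdist_step z p q r m2 g m2' g' c K); trivial; [lra | |].
  - apply Rle_trans with (2 := L1). unfold c.
    assert (mu * (eps / 4) <= mu * sum_f_R0 (excess q p) K)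
      by (apply Rmult_le_compat_l; lra).
    assert (0 < mu * (eps / 4)) by (apply Rmult_lt_0_compat; lra). nra.
  (* Here [x] alone may be small, but [x + d >= eps / 4]: the mass [d] missing from [excess p q]
     returns through the rate difference, up to the factor [q 0 >= 1 - r]. *)
  - apply Rle_trans with (2 := Rplus_le_compat _ _ _ _ L2 L3).
    set (x := sum_f_R0 (excess p q) K) in *. set (d := q 0%nat - p 0%nat) in *.
    replace (1 - p 0%nat - (1 - q 0%nat)) with d by (unfold d; ring).
    assert (0 <= mu * x) by (apply Rmult_le_pos; lra).
    assert (0 <= d * mu) by (apply Rmult_le_pos; [unfold d|]; lra).
    assert (mu * (eps / 4) <= mu * (x + d)) by (apply Rmult_le_compat_l; lra).
    apply Rle_trans with ((1 - r) * (mu * x) + (1 - r) * (d * mu)); [unfold c|].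
    + replace ((1 - r) * (mu * x) + (1 - r) * (d * mu))
        with ((1 - r) * (mu * (x + d))) by ring.
      apply Rmult_le_compat_l; lra.
    + apply Rplus_le_compat; [nra|]. apply Rmult_le_compat_r; lra. }
intros p q m2 g m2' g' Hp Hq Hm2 Hm2' Hg Hg' HV.
destruct (Rle_dec (p 0%nat) (q 0%nat)) as [H|H].
- now apply (main p q m2 g m2' g').
- rewrite (wdist_sym p), (wdist_sym (nl_step p)).
  apply (main q p m2' g' m2 g); trivial; [lra|]. now rewrite wdist_sym.
Qed.

(** * Uniform exponential moments along the orbit *)

Lemma exp_pow_INR (u : R) (k : nat) : exp u ^ k = exp (INR k * u).
Proof.
induction k as [|k IH].
- simpl. now rewrite Rmult_0_l, exp_0.
- rewrite S_INR, Rmult_plus_distr_r, exp_plus, <- IH. simpl. rewrite Rmult_1_l. ring.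
Qed.

(** With [v = INR k * u / 2], this is the square of [v <= exp v]. *)
Lemma sq_le_exp (u : R) (k : nat) : 0 < u -> INR k ^ 2 <= 4 / u ^ 2 * exp u ^ k.
Proof.
intros Hu. rewrite exp_pow_INR.
assert (Hk : 0 <= INR k) by apply pos_INR.
set (v := INR k * u / 2).
assert (Hv : 0 <= v) by (unfold v; nra).
replace (INR k * u) with (v + v) by (unfold v; field). rewrite exp_plus.
assert (H := exp_ineq1_le v).
assert (v ^ 2 <= exp v * exp v) by nra.
replace (INR k ^ 2) with (4 / u ^ 2 * v ^ 2) by (unfold v; field; lra).
apply Rmult_le_compat_l; trivial.
left. apply Rdiv_lt_0_compat; [lra | nra].
Qed.

Lemma second_moment_le_pgf (u : R) (p : nat -> R) (m1 m2 g : R) :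
  0 < u -> has_moments (exp u) p m1 m2 g -> m2 <= 4 / u ^ 2 * g.
Proof.
intros Hu [Hn _ _ H2 Hg].
apply is_series_leR with (2 := H2) (3 := is_series_mulR (4 / u ^ 2) _ _ Hg).
intros n. rewrite <- Rmult_assoc. apply Rmult_le_compat_r; trivial.
now apply sq_le_exp.
Qed.

Lemma initial_moments (u lam r l : R) (p : nat -> R) :
  0 < u <= lam -> is_pmf p -> infinite_sum (fun k => INR k * p k) r ->
  infinite_sum (fun k => exp (lam * INR k) * p k) l ->
  exists m2 g, has_moments (exp u) p r m2 g.
Proof.
intros Hu [Hn Ht] H1 Hl.
apply is_series_Reals in Ht, H1, Hl.
assert (Hg : ex_series (fun k => exp u ^ k * p k)).
{ apply ex_series_abs_dom with (2 := ex_intro _ _ Hl).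
  intros k. assert (0 < exp u ^ k) by (apply pow_lt, exp_pos).
  rewrite Rabs_pos_eq by (apply Rmult_le_pos; [lra | trivial]).
  apply Rmult_le_compat_r; trivial. rewrite exp_pow_INR, (Rmult_comm lam).
  assert (Hk := pos_INR k).
  destruct (Rle_lt_or_eq_dec (INR k * u) (INR k * lam)) as [H' | ->]; [nra | | lra].
  left. now apply exp_increasing. }
destruct Hg as [g Hg].
assert (H2 : ex_series (fun k => INR k ^ 2 * p k)).
{ apply ex_series_abs_dom with
    (2 := ex_intro _ _ (is_series_mulR (4 / u ^ 2) _ _ Hg)).
  intros k. rewrite Rabs_pos_eq by (apply Rmult_le_pos; [apply pow2_ge_0 | trivial]).
  rewrite <- Rmult_assoc. apply Rmult_le_compat_r; trivial. now apply sq_le_exp. }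
destruct H2 as [m2 H2]. now exists m2, g.
Qed.

(* [r < 1] makes some exponential moment contract for the queue whose arrival
   rate is at most [r]. *)
Lemma contracting_exponent (r lam : R) :
  0 <= r < 1 -> 0 < lam ->
  exists u, 0 < u <= lam /\ exp (r * (exp u - 1)) < exp u.
Proof.
(* Any positive [u < 1 - r] contracts: [exp u * (1 - u) <= 1] then gives [r * (exp u - 1) < u]. *)
intros Hr Hl. exists (Rmin lam ((1 - r) / 2)). set (u := Rmin _ _).
assert (H1 : u <= lam) by apply Rmin_l.
assert (H2 : u <= (1 - r) / 2) by apply Rmin_r.
assert (H3 : 0 < u) by (apply Rmin_pos; lra).
split; [lra|]. apply exp_increasing.
assert (H4 := exp_ineq1_le (- u)). rewrite exp_Ropp in H4.
assert (H5 := exp_ineq1_le u).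
assert (H6 : exp u * / exp u = 1) by (field; lra).
set (z := exp u) in *.
assert (z * (1 - u) <= 1) by nra. nra.
Qed.

(** Arrivals come at the very rate of departures, so the mean is conserved, and the second moment
    moves by an amount depending only on [m1] and [p 0]. *)
Lemma nl_step_moments (z : R) (p : nat -> R) (m1 m2 g : R) :
  0 < z -> has_moments z p m1 m2 g ->
  has_moments z (nl_step p) m1
    (m2 + (2 * (1 - p 0%nat) - (1 - p 0%nat) ^ 2 - 2 * m1 * p 0%nat))
    ((p 0%nat + (g - p 0%nat) / z) * exp ((1 - p 0%nat) * (z - 1))).
Proof.
intros Hz H. destruct (occupation_le_mean _ _ _ _ _ H) as [Ho _].
destruct (step_moments _ z p _ _ _ Ho Hz H) as [Sn St S1 S2 Sg].
split; trivial.
- apply is_series_eq with (1 := S1); trivial. ring.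
- apply is_series_eq with (1 := S2); trivial. ring.
Qed.

Lemma nl_law_moments (u r m2 g : R) (p : nat -> R) :
  0 < u -> 0 <= r -> exp (r * (exp u - 1)) < exp u ->
  has_moments (exp u) p r m2 g ->
  exists B, forall t, exists m2 g,
    has_moments (exp u) (nl_law p t) r m2 g /\ g <= B.
Proof.
intros Hu Hr Hz H.
assert (H1 := exp_ineq1_le u).
set (z := exp u) in *. set (E := exp (r * (z - 1))) in *.
assert (HE : 0 < E) by apply exp_pos.
assert (Hth : E / z < 1).
{ apply Rmult_lt_reg_r with z; [lra|]. unfold Rdiv. rewrite Rmult_assoc, Rinv_l; lra. }
(* One step sends [g] below [(1 + g / z) * E], an affine map of slope [E / z < 1] with fixed point
   [E / (1 - E / z)]. A bound above both this point and the initial value propagates. *)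
set (B := Rmax g (E / (1 - E / z))).
assert (HB : E <= B * (1 - E / z)).
{ apply Rle_trans with (E / (1 - E / z) * (1 - E / z)).
  - right. field. split; [lra|]. assert (z - E <> 0) by lra. trivial.
  - apply Rmult_le_compat_r; [lra | apply Rmax_r]. }
exists B. intros t. induction t as [|t [m2t [gt [Ht Hgt]]]].
- exists m2, g. split; trivial. apply Rmax_l.
- assert (Ho := occupation_le_mean _ _ _ _ _ Ht).
  assert (Hp := hm_nonneg _ _ _ _ _ Ht 0%nat).
  eexists. eexists. split.
  + exact (nl_step_moments z _ _ _ _ ltac:(lra) Ht).
  + assert (G0 : 0 <= gt).
    { assert (G := term_le_series _ _ 0 (fun k => Rmult_le_pos _ _
        (pow_le z k ltac:(lra)) (hm_nonneg _ _ _ _ _ Ht k)) (hm_pgf _ _ _ _ _ Ht)).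
      simpl in G. lra. }
    set (x := nl_law p t 0%nat) in *.
    assert (HX : exp ((1 - x) * (z - 1)) <= E).
    { destruct (Rle_lt_or_eq_dec ((1 - x) * (z - 1)) (r * (z - 1))) as [L|L];
        [nra | | unfold E; rewrite L; lra].
      left. now apply exp_increasing. }
    assert (Hzi : 0 < / z) by (apply Rinv_0_lt_compat; lra).
    assert (HY : 0 <= x + (gt - x) / z <= 1 + B / z).
    { assert (/ z <= 1) by (rewrite <- Rinv_1; apply Rinv_le_contravar; lra).
      unfold Rdiv. split; nra. }
    apply Rle_trans with ((1 + B / z) * E).
    * apply Rmult_le_compat; try lra. left; apply exp_pos.
    * unfold Rdiv in *. nra.
Qed.

(** * Convergence of the orbit *)

(** Both laws advance together in [t]. Their distance starts at most at [2 * r], never increases,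
    and loses [gam] at each step taken above [eps], whence an [N] independent of [s]. *)
Lemma nl_law_cauchy (z r M B : R) (p : nat -> R) (eps : R) :
  1 < z -> r < 1 -> 0 < M ->
  (forall t, exists m2 g, has_moments z (nl_law p t) r m2 g /\ m2 <= M /\ g <= B) ->
  0 < eps -> exists N, forall t s, (N <= t)%nat ->
    wdist (nl_law p t) (nl_law p (t + s)) <= eps.
Proof.
intros Hz Hr HM H He.
destruct (wdist_nl_step_decrease z r M B eps Hz Hr HM He) as [gam [Hg D]].
assert (I : forall n s, wdist (nl_law p n) (nl_law p (n + s)) <= eps \/
   wdist (nl_law p n) (nl_law p (n + s)) <= 2 * r - INR n * gam).
{ intros n s. induction n as [|n IH].
  - right. destruct (H 0%nat) as [m2 [g [H1 _]]].
    destruct (H (0 + s)%nat) as [m2' [g' [H2 _]]].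
    destruct (wdist_series _ _ _ _ _ _ _ _ _ H1 H2) as [_ L]. simpl INR. lra.
  - destruct (H n) as [m2 [g [H1 [Ha Hb]]]].
    destruct (H (n + s)%nat) as [m2' [g' [H2 [Hc Hd]]]].
    change (nl_law p (S n)) with (nl_step (nl_law p n)).
    change (nl_law p (S n + s)) with (nl_step (nl_law p (n + s))).
    assert (L := wdist_nl_step_le z _ _ _ _ _ _ _ ltac:(lra) H1 H2).
    destruct (Rle_dec (wdist (nl_law p n) (nl_law p (n + s))) eps) as [K|K];
      [left; lra | right].
    assert (L' := D _ _ _ _ _ _ H1 H2 Ha Hc Hb Hd ltac:(lra)).
    rewrite S_INR. lra. }
destruct (INR_unbounded (2 * r / gam)) as [N HN].
exists N. intros t s Ht. destruct (I t s) as [|L]; trivial.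
apply le_INR in Ht.
assert (2 * r / gam * gam = 2 * r) by (field; lra). nra.
Qed.

Lemma nl_law_cdf_cauchy (z r M B : R) (p : nat -> R) (k : nat) :
  1 < z -> r < 1 -> 0 < M ->
  (forall t, exists m2 g, has_moments z (nl_law p t) r m2 g /\ m2 <= M /\ g <= B) ->
  ex_finite_lim_seq (fun t => sum_f_R0 (nl_law p t) k).
Proof.
intros Hz Hr HM H. apply ex_lim_seq_cauchy_corr. intros eps.
destruct (nl_law_cauchy z r M B p (eps / 2) Hz Hr HM H) as [N HN].
{ destruct eps; simpl; lra. }
assert (A : forall t s, (N <= t)%nat ->
  Rabs (sum_f_R0 (nl_law p t) k - sum_f_R0 (nl_law p (t + s)) k) < eps).
{ intros t s Ht. specialize (HN t s Ht).
  destruct (H t) as [m2 [g [H1 _]]]. destruct (H (t + s)%nat) as [m2' [g' [H2 _]]].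
  destruct (wdist_series _ _ _ _ _ _ _ _ _ H1 H2) as [HS _].
  apply (term_le_series _ _ k) in HS; [|intros; apply Rabs_pos].
  destruct eps as [e He]; simpl in *; lra. }
exists N. intros n m Hn Hm. destruct (Nat.le_ge_cases n m).
- replace m with (n + (m - n))%nat by lia. now apply A.
- rewrite Rabs_minus_sym. replace n with (m + (n - m))%nat by lia. now apply A.
Qed.

Lemma nl_law_pointwise_limit (z r M B : R) (p : nat -> R) :
  1 < z -> r < 1 -> 0 < M ->
  (forall t, exists m2 g, has_moments z (nl_law p t) r m2 g /\ m2 <= M /\ g <= B) ->
  exists pi : nat -> R, forall k, is_lim_seq (fun t => nl_law p t k) (pi k).
Proof.
intros Hz Hr HM H.
exists (fun k => real (Lim_seq (fun t => nl_law p t k))).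
intros k. apply Lim_seq_correct'.
assert (L := fun k => nl_law_cdf_cauchy z r M B p k Hz Hr HM H).
destruct k as [|k]; [exact (L 0%nat)|].
destruct (L (S k)) as [l1 L1], (L k) as [l2 L2].
exists (l1 - l2).
apply is_lim_seq_ext with (2 := is_lim_seq_minus' _ _ _ _ L1 L2).
intros t. rewrite tech5. ring.
Qed.

(** * Bounded sequences and passage to the limit *)

(** Increments eventually above [l / 2 > 0] would push [x] beyond any bound. *)
Lemma bounded_increments_limit_nonpos (x : nat -> R) (l C : R) :
  is_lim_seq (fun t => x (S t) - x t) l -> (forall t, Rabs (x t) <= C) -> l <= 0.
Proof.
intros Hl HC. apply Rnot_lt_le. intros Hpos.
apply is_lim_seq_Reals in Hl.
destruct (Hl (l / 2) ltac:(lra)) as [N HN].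
assert (I : forall n, x N + INR n * (l / 2) <= x (n + N)%nat).
{ induction n as [|n IH]; [simpl; lra|].
  specialize (HN (n + N)%nat ltac:(lia)). unfold Rdist in HN.
  apply Rabs_def2 in HN. rewrite S_INR. simpl Nat.add. lra. }
destruct (INR_unbounded (2 * C / (l / 2))) as [n Hn].
specialize (I n). assert (C1 := HC N). assert (C2 := HC (n + N)%nat).
apply Rabs_le_between in C1, C2.
assert (2 * C / (l / 2) * (l / 2) = 2 * C) by (field; lra). nra.
Qed.

Lemma bounded_increments_limit (x : nat -> R) (l C : R) :
  is_lim_seq (fun t => x (S t) - x t) l -> (forall t, Rabs (x t) <= C) -> l = 0.
Proof.
intros Hl HC. apply Rle_antisym.
- now apply bounded_increments_limit_nonpos with x C.
- apply Ropp_le_cancel. rewrite Ropp_0.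
  apply bounded_increments_limit_nonpos with (fun t => - x t) C.
  + apply is_lim_seq_opp in Hl. apply is_lim_seq_ext with (2 := Hl).
    intros t; ring.
  + intros t. now rewrite Rabs_Ropp.
Qed.

Lemma is_lim_seq_sum (f : nat -> nat -> R) (l : nat -> R) (n : nat) :
  (forall k, (k <= n)%nat -> is_lim_seq (fun t => f t k) (l k)) ->
  is_lim_seq (fun t => sum_f_R0 (f t) n) (sum_f_R0 l n).
Proof.
intros H. induction n as [|n IH]; [now apply H|].
apply (is_lim_seq_plus' (fun t => sum_f_R0 (f t) n)); [apply IH | apply H]; auto.
Qed.

(** At each site only finitely many masses enter, so pointwise convergence is enough. *)
Lemma is_lim_seq_step (m : nat -> R) (p : nat -> nat -> R) (m' : R) (p' : nat -> R)
  (k : nat) :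
  is_lim_seq m m' -> (forall j, is_lim_seq (fun t => p t j) (p' j)) ->
  is_lim_seq (fun t => step (m t) (p t) k) (step m' p' k).
Proof.
intros Hm Hp. unfold step.
apply (is_lim_seq_sum (fun t j => dec_law (p t) j * poisson (m t) (k - j))).
intros j _. apply is_lim_seq_mult'.
- destruct j; simpl; [now apply is_lim_seq_plus' | apply Hp].
- apply (is_lim_seq_continuous (fun x => poisson x (k - j))); trivial.
  apply continuity_pt_filterlim, (ex_derive_continuous (fun x => poisson x (k - j))).
  unfold poisson. now auto_derive.
Qed.

(** * Rate and uniqueness of the invariant law *)

(** The equation is quadratic in [rho], with roots [1 + r] plus or minus [sqrt (1 + r ^ 2)]; the
    bound [rho <= r] selects the smaller. *)
Lemma rho_r_spec (r rho : R) :
  0 <= r -> rho <= r -> 2 * r * (1 - rho) = 2 * rho - rho ^ 2 -> rho = rho_r r.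
Proof.
intros Hr Hrho E. unfold rho_r.
replace (1 + r ^ 2) with ((1 + r - rho) ^ 2) by nra.
rewrite sqrt_pow2 by lra. ring.
Qed.

(** The equation at [n] gives [x (n + 1)] the nonzero coefficient [poisson rho 0], so the earlier
    values determine it. Arbitrary real sequences are allowed, for use on a signed combination of
    two laws. *)
Lemma step_fixed_zero (rho : R) (x : nat -> R) :
  (forall k, step rho x k = x k) -> x 0%nat = 0 -> forall k, x k = 0.
Proof.
intros Hx H0.
assert (Hpo : poisson rho 0 <> 0).
{ unfold poisson. simpl. assert (0 < exp (- rho)) by apply exp_pos. lra. }
assert (I : forall n k, (k <= n)%nat -> x k = 0).
{ induction n as [|n IH]; intros k Hk; [now replace k with 0%nat by lia|].
  destruct (Nat.eq_dec k (S n)) as [->|]; [|apply IH; lia].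
  assert (E := Hx n). rewrite (IH n) in E by lia. unfold step in E.
  destruct n as [|n].
  - simpl sum_f_R0 in E. rewrite H0 in E.
    apply Rmult_integral in E. destruct E as [E|E]; [lra | contradiction].
  - rewrite tech5, sum_eq_R0, Nat.sub_diag in E.
    + simpl dec_law in E. rewrite Rplus_0_l in E.
      apply Rmult_integral in E. destruct E as [E|E]; [trivial | contradiction].
    + intros j Hj. destruct j as [|j]; simpl dec_law.
      * rewrite (IH 0%nat), (IH 1%nat) by lia. ring.
      * rewrite IH by lia. ring. }
intros k. now apply (I k).
Qed.

Lemma MD1_invariant_unique (rho : R) (pi pi' : nat -> R) (k : nat) :
  MD1_invariant rho pi -> MD1_invariant rho pi' -> pi k = pi' k.
Proof.
intros [[_ T] F] [[_ T'] F']. apply is_series_Reals in T, T'.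
(* This combination is fixed by the linear map [step rho] and vanishes at 0. Summing it over [j]
   then gives [pi 0 = pi' 0]. *)
assert (Z : forall j, pi' 0%nat * pi j - pi 0%nat * pi' j = 0).
{ apply (step_fixed_zero rho); [|ring].
  intros j. rewrite <- (F j), <- (F' j).
  unfold step. rewrite !scal_sum, <- minus_sum. apply sum_eq.
  intros i _. destruct i; simpl; ring. }
assert (E0 : pi' 0%nat * 1 = pi 0%nat * 1).
{ apply is_series_eq_val with (fun j => pi' 0%nat * pi j).
  - now apply is_series_mulR.
  - apply is_series_eq with (1 := is_series_mulR (pi 0%nat) _ _ T'); trivial.
    intros j. specialize (Z j). lra. }
assert (N0 : pi 0%nat <> 0).
{ intros H. assert (W := step_fixed_zero rho pi F H).
  assert (0 = 1); [|lra].
  apply is_series_eq_val with (2 := T).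
  apply is_series_eq with (1 := geometric_series 0 0 ltac:(lra)); [|lra].
  intros j. rewrite W. ring. }
specialize (Z k).
assert (E : pi 0%nat * (pi k - pi' k) = 0).
{ rewrite <- Z. replace (pi' 0%nat) with (pi 0%nat) by lra. ring. }
apply Rmult_integral in E. destruct E; [contradiction | lra].
Qed.

Lemma nl_law_limit_rho (z r M B : R) (p pi : nat -> R) :
  1 < z -> 0 <= r < 1 ->
  (forall t, exists m2 g, has_moments z (nl_law p t) r m2 g /\ m2 <= M /\ g <= B) ->
  (forall k, is_lim_seq (fun t => nl_law p t k) (pi k)) ->
  1 - pi 0%nat = rho_r r.
Proof.
intros Hz Hr H Hpi.
set (x := fun t => Series (fun k => INR k ^ 2 * nl_law p t k)).
(* The increment of the second moment as a function of the mass at 0; it tends to 0 because [x] is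
   bounded and the increments converge. *)
set (inc := fun a => 2 * (1 - a) - (1 - a) ^ 2 - 2 * r * a).
assert (Hinc : forall t, x (S t) - x t = inc (nl_law p t 0%nat)).
{ intros t. destruct (H t) as [m2 [g [Ht _]]].
  assert (Hs := nl_step_moments z _ _ _ _ ltac:(lra) Ht).
  assert (E1 := is_series_unique _ _ (hm_second _ _ _ _ _ Ht)).
  assert (E2 := is_series_unique _ _ (hm_second _ _ _ _ _ Hs)).
  unfold x. change (nl_law p (S t)) with (nl_step (nl_law p t)).
  rewrite E1, E2. unfold inc. ring. }
assert (Hx : forall t, Rabs (x t) <= M).
{ intros t. destruct (H t) as [m2 [g [Ht [Hm _]]]].
  assert (E1 := is_series_unique _ _ (hm_second _ _ _ _ _ Ht)).
  fold (x t) in E1. rewrite E1.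
  rewrite Rabs_pos_eq; trivial.
  assert (T := term_le_series _ _ 0 (fun k => Rmult_le_pos _ _
    (pow2_ge_0 (INR k)) (hm_nonneg _ _ _ _ _ Ht k)) (hm_second _ _ _ _ _ Ht)).
  simpl in T. lra. }
assert (L : is_lim_seq (fun t => inc (nl_law p t 0%nat)) (inc (pi 0%nat))).
{ apply is_lim_seq_continuous; [|apply Hpi].
  apply continuity_pt_filterlim, (ex_derive_continuous inc).
  unfold inc. now auto_derive. }
apply (is_lim_seq_ext _ _ _ (fun t => eq_sym (Hinc t))) in L.
apply bounded_increments_limit with (C := M) in L; trivial.
(* Rates at most [r] along the orbit stay so in the limit, which selects the root in
   [rho_r_spec]. *)
assert (Hle : 1 - r <= pi 0%nat).
{ apply (is_lim_seq_le (fun _ => 1 - r) (fun t => nl_law p t 0%nat) (1 - r) (pi 0%nat)).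
  - intros t. destruct (H t) as [m2 [g [Ht _]]].
    assert (Ho := occupation_le_mean _ _ _ _ _ Ht). lra.
  - apply is_lim_seq_const.
  - apply Hpi. }
apply rho_r_spec; [lra | lra |]. unfold inc in L. nra.
Qed.

(** Tightness: the geometric bound on the tails is uniform in [t], so no mass escapes in the
    limit. *)
Lemma pointwise_limit_pmf (z r M B : R) (q : nat -> nat -> R) (pi : nat -> R) :
  1 < z ->
  (forall t, exists m2 g, has_moments z (q t) r m2 g /\ m2 <= M /\ g <= B) ->
  (forall k, is_lim_seq (fun t => q t k) (pi k)) -> is_pmf pi.
Proof.
intros Hz H Hpi. split.
- intros k. apply (is_lim_seq_le (fun _ => 0) (fun t => q t k) 0 (pi k)).
  + intros t. destruct (H t) as [m2 [g [Ht _]]]. apply Ht.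
  + apply is_lim_seq_const.
  + apply Hpi.
- assert (Hy : 0 < / z < 1).
  { split; [apply Rinv_0_lt_compat; lra|]. rewrite <- Rinv_1.
    apply Rinv_lt_contravar; lra. }
  assert (Hc : forall n, is_lim_seq (fun t => sum_f_R0 (q t) n) (sum_f_R0 pi n))
    by (intros; apply is_lim_seq_sum; auto).
  apply is_series_Reals, is_series_lim.
  apply is_lim_seq_le_le with (u := fun n => 1 - B * (/ z) ^ n) (w := fun _ => 1).
  + intros n. split.
    * apply (is_lim_seq_le (fun _ => 1 - B * (/ z) ^ n) (fun t => sum_f_R0 (q t) n)
        (1 - B * (/ z) ^ n) (sum_f_R0 pi n)); [ | apply is_lim_seq_const | apply Hc].
      intros t. destruct (H t) as [m2 [g [Ht [_ Hg]]]].
      assert (T := tail_geometric z _ _ _ _ n ltac:(lra) Ht).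
      assert (0 < (/ z) ^ n) by (apply pow_lt; lra).
      unfold tail in T. nra.
    * apply (is_lim_seq_le (fun t => sum_f_R0 (q t) n) (fun _ => 1)
        (sum_f_R0 pi n) 1); [ | apply Hc | apply is_lim_seq_const].
      intros t. destruct (H t) as [m2 [g [[Hn Ht _ _ _] _]]].
      now apply partial_sum_le.
  + replace (Finite 1) with (Finite (1 - B * 0)) by (f_equal; ring).
    apply is_lim_seq_minus'; [apply is_lim_seq_const|].
    apply is_lim_seq_mult'; [apply is_lim_seq_const|].
    apply is_lim_seq_geom. rewrite Rabs_pos_eq; lra.
  + apply is_lim_seq_const.
Qed.

Theorem theorem2p5 (p0 : nat -> R) (r : R) :
  is_pmf p0 ->
  infinite_sum (fun k => INR k * p0 k) r ->
  0 <= r < 1 ->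
  (exists lam : R, 0 < lam /\
     exists l : R, infinite_sum (fun k => exp (lam * INR k) * p0 k) l) ->
  (exists pi : nat -> R, MD1_invariant (rho_r r) pi) /\
  (forall pi : nat -> R, MD1_invariant (rho_r r) pi ->
     conv_in_law (nl_law p0) pi).
Proof.
intros Hp Hm Hr [lam [Hlam [l Hl]]].
destruct (contracting_exponent r lam Hr Hlam) as [u [Hu Hz]].
destruct (initial_moments u lam r l p0 Hu Hp Hm Hl) as [m2 [g H0]].
destruct (nl_law_moments u r m2 g p0 ltac:(lra) ltac:(lra) Hz H0) as [B HB].
(* The maximum with 1 keeps [M] positive, as the contraction estimate asks. *)
set (M := 4 / u ^ 2 * Rmax B 1).
assert (Hu2 : 0 < 4 / u ^ 2) by (apply Rdiv_lt_0_compat; [lra | nra]).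
assert (HM : 0 < M).
{ apply Rmult_lt_0_compat; trivial. assert (H := Rmax_r B 1). lra. }
assert (H : forall t, exists m2 g,
  has_moments (exp u) (nl_law p0 t) r m2 g /\ m2 <= M /\ g <= B).
{ intros t. destruct (HB t) as [m2t [gt [Ht Hg]]]. exists m2t, gt.
  repeat split; try apply Ht; trivial.
  apply Rle_trans with (1 := second_moment_le_pgf u _ _ _ _ (proj1 Hu) Ht).
  apply Rmult_le_compat_l; [lra|]. apply Rle_trans with (1 := Hg), Rmax_l. }
assert (Hz1 : 1 < exp u) by (assert (E := exp_ineq1_le u); lra).
destruct (nl_law_pointwise_limit (exp u) r M B p0 Hz1 (proj2 Hr) HM H) as [pi Hpi].
assert (Hinv : MD1_invariant (rho_r r) pi).
{ split; [now apply (pointwise_limit_pmf (exp u) r M B (nl_law p0))|].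
  intros k. rewrite <- (nl_law_limit_rho (exp u) r M B p0 pi Hz1 Hr H Hpi).
  (* [nl_law p0 (S t) k] tends to [step] of the limit by continuity, and to [pi k] as a shifted
     sequence; equating the two gives invariance. *)
  assert (L1 := is_lim_seq_step (fun t => 1 - nl_law p0 t 0%nat) (nl_law p0)
    (1 - pi 0%nat) pi k
    (is_lim_seq_minus' _ _ _ _ (is_lim_seq_const 1) (Hpi 0%nat)) Hpi).
  assert (L2 := is_lim_seq_incr_1 (fun t => nl_law p0 t k) (pi k)).
  apply L2 in Hpi as L3; clear L2.
  assert (E := is_lim_seq_unique _ _ L1).
  apply is_lim_seq_unique in L3. simpl nl_law in L3. rewrite E in L3.
  now injection L3. }
split; [now exists pi|].
intros pi' Hpi' k. apply is_lim_seq_Reals.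
now rewrite <- (MD1_invariant_unique _ _ _ k Hinv Hpi').
Qed.
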